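(* Let $\ell\ge2$, let $\mathfrak{h}$ be a Lie subalgebra of $\mathfrak{sp}(\ell)$, and let $\phi$ be the standard representation of $\mathfrak{sp}(\ell)$ (highest weight $(1,0,\ldots,0)$, dimension $2\ell$). The following are equivalent: (a) $\mathfrak{h}=\mathfrak{sp}(\ell)$; (b) $(\mathrm{Sym}^2\phi)|_{\mathfrak{h}}$ is irreducible; (c) $(\mathrm{Sym}^2\phi)|_{\mathfrak{h}}$ is irreducible, $(\mathrm{Alt}^2\phi)|_{\mathfrak{h}}$ splits into two irreducible components, and no irreducible component (of $(\phi\otimes\phi)|_{\mathfrak{h}}$) occurs more than once; (d) $(\phi\otimes\phi)|_{\mathfrak{h}}$ splits into three pairwise inequivalent irreducible components; (e) the vector space of all complex matrices commuting with $(\phi\otimes\phi)(h)$ for all $h\in\mathfrak{h}$ has dimension three.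
   Context: $\mathfrak{sp}(\ell)=\mathfrak{sp}(2\ell,\mathbb C)\cap\mathfrak{su}(2\ell)$, realized as matrices acting on $V=\mathbb C^{2\ell}$ (the standard representation). $\phi\otimes\phi$ acts on $V\otimes V$ by $\phi(g)\otimes\mathbb 1+\mathbb 1\otimes\phi(g)$; $\mathrm{Alt}^2\phi$ and $\mathrm{Sym}^2\phi$ are its restrictions to the antisymmetric and symmetric subspaces of $V\otimes V$, so $\phi\otimes\phi=\mathrm{Alt}^2\phi\oplus\mathrm{Sym}^2\phi$. Irreducibility is over $\mathbb C$. *)

(* Defs.v *)
From HB Require Import structures.
From mathcomp Require Import all_boot all_order all_algebra.
From mathcomp Require Import reals.
From mathcomp.real_closed Require Import complex mxtens.
Set Implicit Arguments. Unset Strict Implicit. Unset Printing Implicit Defensive.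
Import Order.TTheory GRing.Theory Num.Theory.
Local Open Scope ring_scope.

Section SpDefs.
Variable R : realType.
Local Notation C := R[i].

Definition Jmx (l : nat) : 'M[C]_(l + l) := block_mx 0 1%:M (- 1%:M) 0.

(* sp(l) = sp(2l,C) ∩ su(2l), as a real Lie algebra of complex matrices. *)
Definition in_sp (l : nat) (X : 'M[C]_(l + l)) : Prop :=
  X^T *m Jmx l + Jmx l *m X = 0 /\
  (map_mx Num.conj X)^T = - X /\
  \tr X = 0.

Definition lie_subalgebra_sp (l : nat) (h : 'M[C]_(l + l) -> Prop) : Prop :=
  [/\ h 0,
      (forall X Y, h X -> h Y -> h (X + Y)),
      (forall (r : C) X, r \is Num.real -> h X -> h (r *: X)),
      (forall X Y, h X -> h Y -> h (X *m Y - Y *m X)) &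
      (forall X, h X -> in_sp X)].

Definition tens_rep (l : nat) (X : 'M[C]_(l + l)) : 'M[C]_((l + l) * (l + l)) :=
  X *t (1%:M : 'M[C]_(l + l)) + (1%:M : 'M[C]_(l + l)) *t X.

Definition swap_mx (n : nat) : 'M[C]_(n * n) :=
  \matrix_(a, b) ((((mxtens_unindex a).1 == (mxtens_unindex b).2) &&
                   ((mxtens_unindex a).2 == (mxtens_unindex b).1))%:R).

(* Subspaces of V ⊗ V are represented, as in mxalgebra, by the row space of a
   matrix; vectors are row vectors, so the (column-vector) action
   w |-> (phi⊗phi)(X) w is encoded as v |-> v *m ((phi⊗phi)(X))^T. *)
Definition Sym2 (n : nat) : 'M[C]_(n * n) := kermx (swap_mx n - 1%:M).
Definition Alt2 (n : nat) : 'M[C]_(n * n) := kermx (swap_mx n + 1%:M).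

Section Reps.
Variable l : nat.
Local Notation N := ((l + l) * (l + l)).
Variable h : 'M[C]_(l + l) -> Prop.

Definition row_act (X : 'M[C]_(l + l)) : 'M[C]_N := (tens_rep X)^T.

Definition invariant (U : 'M[C]_N) : Prop :=
  forall X, h X -> (U *m row_act X <= U)%MS.

Definition irreducible_on (U : 'M[C]_N) : Prop :=
  [/\ invariant U, \rank U != 0%N &
      forall W : 'M[C]_N, invariant W -> (W <= U)%MS ->
        \rank W = 0%N \/ (U <= W)%MS].

(* The subrepresentations on invariant subspaces U and W are equivalent:
   some linear map f restricts to an isomorphism U -> W intertwining the
   h-actions. *)
Definition equiv_on (U W : 'M[C]_N) : Prop :=
  exists f : 'M[C]_N,
    [/\ (U *m f == W)%MS, \rank U = \rank W &
        forall X, h X -> U *m (row_act X *m f - f *m row_act X) = 0].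

Definition direct_sum2 (U U1 U2 : 'M[C]_N) : Prop :=
  (U1 + U2 == U)%MS /\ (\rank U1 + \rank U2 = \rank U)%N.

Definition in_commutant (M : 'M[C]_N) : Prop :=
  forall X, h X -> M *m tens_rep X = tens_rep X *m M.

Definition commutant_dim (d : nat) : Prop :=
  exists B : 'M[C]_(d, N * N),
    row_free B /\ forall M : 'M[C]_N, in_commutant M <-> (mxvec M <= B)%MS.

End Reps.
End SpDefs.

(* Main.v *)
Require Import Defs.
From HB Require Import structures.
From mathcomp Require Import all_boot all_order all_algebra.
From mathcomp Require Import boolp reals ring sesquilinear spectral.
From mathcomp.real_closed Require Import complex mxtens.
Set Implicit Arguments. Unset Strict Implicit. Unset Printing Implicit Defensive.
Import Order.TTheory GRing.Theory Num.Theory.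
Local Open Scope ring_scope.
Local Open Scope sesquilinear_scope.
Local Notation "B ^!" :=
  (orthomx Num.conj (mx_of_hermitian (hermitian1mx _)) B) : matrix_set_scope.
Local Notation invariant := Defs.invariant.

(** The chain of implications is (a) => (c) => (d) => (e) => (b) => (a).

    Identify V ⊗ V with square matrices, on which X acts by A |-> XA + AX^T.
    For (a) => (c), the rank-one elements X_u = u u^T J of sp(2l,C) act by
    X_u X_u A = 2 q_A(u) u u^T on symmetric A (q_A a nonzero quadratic form if
    A <> 0), and by X_u A = b u^T - u b^T, b = A J^T u, on antisymmetric A. If W
    is an invariant subspace of Sym^2 or of the orthogonal of J in Alt^2, and
    A in W, Z in the Hermitian complement of W are both nonzero, then W and its
    complement contain all these tensors; their pairing is a polynomial
    identity in the vectors, which fails at a suitable point. The square of X_u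
    kills Alt^2 but not Sym^2, and X_u kills J but not the rest of Alt^2, so
    the three pieces are inequivalent.

    (d) => (e) is Schur's lemma. For (e) => (b), a proper invariant subspace
    of Sym^2 and its complement would, with the two pieces of Alt^2, give four
    independent projections in the commutant. For (b) => (a), (h + ih) J^T is
    an invariant subspace of Sym^2, hence all of it, so h + ih = sp(2l,C), and
    the skew-Hermitian elements of h + ih are those of h. *)

(** * Quadratic forms *)

Section Bilinear.
Variables (F : numFieldType) (n : nat).
Implicit Types (M K B E : 'M[F]_n) (u v w : 'cV[F]_n) (c : F).

(** Bilinear even over the complex numbers: nothing is conjugated, so that nonvanishing conditions
    remain polynomial. *)
Definition bform M u v : F := (u^T *m M *m v) 0 0.
Definition dot u v : F := bform 1%:M u v.

Lemma dotE u v : u^T *m v = (dot u v)%:M.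
Proof. by rewrite /dot /bform mulmx1 [LHS]mx11_scalar. Qed.

Lemma outer_mul u v w : u *m v^T *m w = dot v w *: u.
Proof. by rewrite -mulmxA dotE mul_mx_scalar. Qed.

Lemma tr_outer u v w y : \tr (u *m v^T *m (w *m y^T)) = dot v w * dot y u.
Proof.
rewrite mulmxA outer_mul -scalemxAl mxtraceZ mxtrace_mulC dotE.
by rewrite mxtrace_scalar mulr1n.
Qed.

Lemma bformE M u v : bform M u v = dot u (M *m v).
Proof. by rewrite /dot /bform mulmx1 mulmxA. Qed.

Lemma bformDl M u v w : bform M (u + v) w = bform M u w + bform M v w.
Proof. by rewrite /bform linearD !mulmxDl mxE. Qed.

Lemma bformDr M u v w : bform M u (v + w) = bform M u v + bform M u w.
Proof. by rewrite /bform !mulmxDr mxE. Qed.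

Lemma bformZl M c u v : bform M (c *: u) v = c * bform M u v.
Proof. by rewrite /bform linearZ -!scalemxAl mxE. Qed.

Lemma bformZr M c u v : bform M u (c *: v) = c * bform M u v.
Proof. by rewrite /bform -!scalemxAr mxE. Qed.

Definition bform_lin := (bformDl, bformDr, bformZl, bformZr).

Lemma bform_tr M u v : bform M^T u v = bform M v u.
Proof.
have -> : bform M v u = ((v^T *m M *m u)^T) 0 0 by rewrite mxE.
by rewrite !trmx_mul trmxK mulmxA.
Qed.

Lemma dotC u v : dot u v = dot v u.
Proof. by rewrite /dot -bform_tr trmx1. Qed.

Lemma bform_anti M u : M^T = - M -> bform M u u = 0.
Proof.
move=> MT; apply/eqP; rewrite -eqNr; apply/eqP.
by rewrite -[RHS]bform_tr MT /bform mulmxN mulNmx [RHS]mxE.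
Qed.

Lemma bform_delta M i j : bform M (delta_mx i 0) (delta_mx j 0) = M i j.
Proof. by rewrite /bform trmx_delta -rowE -colE !mxE. Qed.

Lemma tr_wedge u v w y :
  \tr ((u *m v^T - v *m u^T) *m (w *m y^T - y *m w^T)) =
  2 * (dot v w * dot u y - dot v y * dot u w).
Proof.
rewrite mulmxBl !mulmxBr !(raddfB (@mxtrace F n)) /= !tr_outer.
by rewrite (dotC y u) (dotC w u) (dotC y v) (dotC w v); ring.
Qed.

Lemma dot_adj M u v : dot (M *m u) v = dot u (M^T *m v).
Proof. by rewrite /dot /bform !mulmx1 trmx_mul mulmxA. Qed.

(** Along the line [u + t *: v] both forms become polynomials in [t]. The one for [M] has a nonzero
    constant term, the one for [K] a nonzero coefficient of [t^2], so some natural number is not a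
    root of their product. *)
Lemma common_nonzero M K u v :
  bform M u u != 0 -> bform K v v != 0 ->
  exists2 w, bform M w w != 0 & bform K w w != 0.
Proof.
move=> Mu Kv.
pose p Q : {poly F} := (bform Q u u)%:P +
  (bform Q u v + bform Q v u) *: 'X + bform Q v v *: 'X^2.
have pE Q t : (p Q).[t] = bform Q (u + t *: v) (u + t *: v).
  by rewrite /p !(hornerD, hornerZ, hornerC, hornerX, hornerXn) !bform_lin; ring.
have pM : p M != 0.
  apply: contraNneq Mu => pM0; move: (pE M 0).
  by rewrite pM0 horner0 scale0r addr0 => <-.
have pK : p K != 0.
  apply: contraNneq Kv => pK0; have: (p K)`_2 = 0 by rewrite pK0 coef0.
  by rewrite /p !coefD coefC !coefZ coefX coefXn /= mulr0 mulr1 !add0r => ->.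
have pMK : p M * p K != 0 by rewrite mulf_neq0.
pose s : seq F := [seq i%:R | i <- iota 0 (size (p M * p K))].
have us : uniq s.
  by rewrite map_inj_uniq ?iota_uniq // => i j /eqP; rewrite eqr_nat => /eqP.
have /allPn[t _] : ~~ all (root (p M * p K)) s.
  apply/negP => /(max_poly_roots pMK)/(_ us).
  by rewrite size_map size_iota ltnn.
rewrite rootE hornerM mulf_eq0 negb_or !pE => /andP[tM tK].
by exists (u + t *: v).
Qed.

Lemma sym_form_neq0 M : M^T = M -> M != 0 -> exists u, bform M u u != 0.
Proof.
move=> Ms M0; apply/not_existsP => q0; move/eqP: M0; apply.
have {}q0 u : bform M u u = 0 by apply/eqP/negP => /negP; exact: q0.
apply/matrixP => i j; rewrite !mxE.
have := q0 (delta_mx i 0 + delta_mx j 0); rewrite !bform_lin !q0 add0r addr0.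
have Mji : M j i = M i j by rewrite -[in RHS]Ms mxE.
by rewrite !bform_delta Mji -mulr2n => /eqP; rewrite mulrn_eq0 /= => /eqP.
Qed.

(** The value is [dot (B *m u) (K *m u)], where [K *m u] is orthogonal to [u]: it detects that [u]
    is not an eigenvector of [B]. *)
Lemma nonscalar_form B : ~~ is_scalar_mx B ->
  exists K u, K^T = - K /\ bform (B^T *m K) u u != 0.
Proof.
move=> Bns; apply: contrapT => q0; move/negP: Bns; apply.
have {}q0 K u : K^T = - K -> bform (B^T *m K) u u = 0.
  by move=> KT; apply/eqP/negP => /negP h; apply: q0; exists K, u.
have key i j : i != j -> B j i = 0 /\ B i i = B j j.
  (* The form is evaluated at two basis vectors, giving [B j i] and [- B i j], then at their sum,
     which leaves [B j j - B i i]. *)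
  move=> ij; pose K : 'M[F]_n := delta_mx j i - delta_mx i j.
  have KT : K^T = - K by rewrite /K linearB /= !trmx_delta opprB.
  have KE a b : bform (B^T *m K) (delta_mx a 0) (delta_mx b 0) =
      B j a *+ (b == i) - B i a *+ (b == j).
    have dE p q : (B^T *m delta_mx p q) a b = B p a *+ (b == q).
      rewrite mxE (bigD1 p) //= big1 => [|k kp].
        by rewrite !mxE eqxx addr0 /= mulr_natr.
      by rewrite !mxE (negPf kp) mulr0.
    by rewrite bform_delta mulmxBr -!dE !mxE.
  have ji : B j i = 0.
    by have := q0 K (delta_mx i 0) KT; rewrite KE eqxx (negPf ij) subr0.
  have jj : B i j = 0.
    have := q0 K (delta_mx j 0) KT; rewrite KE eqxx eq_sym (negPf ij) sub0r.
    by move/eqP; rewrite oppr_eq0 => /eqP.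
  split=> //; have := q0 K (delta_mx i 0 + delta_mx j 0) KT.
  rewrite !bform_lin !KE !eqxx ![j == i]eq_sym !(negPf ij) !mulr1n !mulr0n ji jj.
  by move=> h; apply/esym/subr0_eq; rewrite -h; ring.
case: n B key {q0} => [|m] B key.
  by apply/is_scalar_mxP; exists 0; rewrite [B]flatmx0 [RHS]flatmx0.
apply/is_scalar_mxP; exists (B 0 0); apply/matrixP => i j; rewrite !mxE.
have [<-|ij] := eqVneq i j; last by have [] := key j i; rewrite // eq_sym.
by have [->//|i0] := eqVneq i 0; have [] := key i 0 i0.
Qed.

(* One of [K u], [K' u], [K u + K' u] lies off both hyperplanes. *)
Lemma nonscalar_common B E : ~~ is_scalar_mx B -> ~~ is_scalar_mx E ->
  exists u y, [/\ dot u y = 0, dot (B *m u) y != 0 & dot (E *m u) y != 0].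
Proof.
move=> /nonscalar_form[K [u0 [KT Ku]]] /nonscalar_form[K' [u1 [KT' Ku']]].
have [u Bu Eu] := common_nonzero Ku Ku'.
have ortho Q : Q^T = - Q -> dot u (Q *m u) = 0.
  by move=> QT; rewrite -bformE bform_anti.
rewrite bformE -mulmxA -dot_adj in Bu; rewrite bformE -mulmxA -dot_adj in Eu.
have [Eu0|?] := eqVneq (dot (E *m u) (K *m u)) 0; last first.
  by exists u, (K *m u); rewrite ortho.
have [Bu0|?] := eqVneq (dot (B *m u) (K' *m u)) 0; last first.
  by exists u, (K' *m u); rewrite ortho.
exists u, (K *m u + K' *m u).
have dotD (a b c : 'cV[F]_n) : dot a (b + c) = dot a b + dot a c.
  by rewrite /dot bformDr.
by rewrite !dotD Eu0 Bu0 !ortho // !addr0 !add0r.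
Qed.
End Bilinear.

(** * Tensors as matrices *)

Section Vectorization.
Variables (F : comNzRingType) (n : nat).
Implicit Types (A P Q : 'M[F]_n).

(** Coordinates are ordered by [mxtens_index] in order to agree with the Kronecker product [*t]. *)
Definition tens_of (w : 'rV[F]_(n * n)) : 'M[F]_n :=
  \matrix_(i, j) w 0 (mxtens_index (i, j)).
Definition vec_of A : 'rV[F]_(n * n) :=
  \row_k A (mxtens_unindex k).1 (mxtens_unindex k).2.

Lemma vec_ofK : cancel vec_of tens_of.
Proof. by move=> A; apply/matrixP => i j; rewrite !mxE mxtens_indexK. Qed.

Lemma tens_ofK : cancel tens_of vec_of.
Proof.
by move=> w; apply/rowP => k; rewrite !mxE -surjective_pairing mxtens_unindexK.
Qed.

Fact vec_of_linear : linear vec_of.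
Proof. by move=> c A B; apply/rowP => k; rewrite !mxE. Qed.
HB.instance Definition _ := GRing.isLinear.Build _ _ _ _ vec_of vec_of_linear.

Lemma vec_of_eq0 A : (vec_of A == 0) = (A == 0).
Proof. by rewrite -(inj_eq (can_inj vec_ofK)) linear0. Qed.

Lemma sum_mxtens (f : 'I_n * 'I_n -> F) :
  \sum_(k < n * n) f (mxtens_unindex k) = \sum_i \sum_j f (i, j).
Proof.
rewrite pair_big (reindex (@mxtens_unindex n n)).
  by apply: eq_bigr => k _; case: (mxtens_unindex k).
by exists (@mxtens_index n n) => i; rewrite (mxtens_indexK, mxtens_unindexK).
Qed.

Lemma vec_of_mul A P Q : vec_of A *m (P *t Q) = vec_of (P^T *m A *m Q).
Proof.
apply/rowP => k; case: (mxtens_indexP k) => i j; rewrite !mxE mxtens_indexK /=.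
under eq_bigr do rewrite !mxE mxtens_indexK /=.
rewrite (sum_mxtens (fun p => A p.1 p.2 * (P p.1 i * Q p.2 j))) exchange_big /=.
apply: eq_bigr => b _; rewrite mxE mulr_suml; apply: eq_bigr => a _.
by rewrite !mxE; ring.
Qed.

Lemma vec_of_dot A P : vec_of A *m (vec_of P)^T = (\tr (A *m P^T))%:M.
Proof.
rewrite [LHS]mx11_scalar mxE; congr _%:M.
under eq_bigr do rewrite !mxE.
rewrite (sum_mxtens (fun p => A p.1 p.2 * P p.1 p.2)).
by apply: eq_bigr => i _; rewrite mxE; apply: eq_bigr => j _; rewrite mxE.
Qed.
End Vectorization.

Section TensorSquare.
Variables (R : realType) (n : nat).
Local Notation C := R[i].
Implicit Types (A X : 'M[C]_n).

Lemma vec_ofP (w : 'rV[C]_(n * n)) : exists A : 'M[C]_n, w = vec_of A.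
Proof. by exists (tens_of w); rewrite tens_ofK. Qed.

Lemma vec_of_swap A : vec_of A *m swap_mx R n = vec_of A^T.
Proof.
apply/rowP => k; case: (mxtens_indexP k) => i j; rewrite !mxE mxtens_indexK /=.
under eq_bigr do rewrite !mxE mxtens_indexK /=.
rewrite (sum_mxtens (fun p => A p.1 p.2 * ((p.1 == j) && (p.2 == i))%:R)).
rewrite (bigD1 j) //= (bigD1 i) //= !eqxx mulr1 !big1 ?addr0 // => [k' | k'] kj.
  by rewrite big1 // => m _; rewrite (negPf kj) mulr0.
by rewrite (negPf kj) andbF mulr0.
Qed.

Lemma sub_Sym2 A : (vec_of A <= Sym2 R n)%MS = (A^T == A).
Proof.
rewrite (sameP sub_kermxP eqP) mulmxBr mulmx1 vec_of_swap.
by rewrite -linearB vec_of_eq0 subr_eq0.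
Qed.

Lemma sub_Alt2 A : (vec_of A <= Alt2 R n)%MS = (A^T == - A).
Proof.
rewrite (sameP sub_kermxP eqP) mulmxDr mulmx1 vec_of_swap.
by rewrite -linearD vec_of_eq0 addr_eq0.
Qed.

Lemma Sym2_tr A : (vec_of A <= Sym2 R n)%MS -> A^T = A.
Proof. by rewrite sub_Sym2 => /eqP. Qed.

Lemma Alt2_tr A : (vec_of A <= Alt2 R n)%MS -> A^T = - A.
Proof. by rewrite sub_Alt2 => /eqP. Qed.

Lemma ortho_vec_of A B :
  (vec_of A <= (vec_of B)^!)%MS = (\tr (A *m B^t*) == 0).
Proof.
rewrite orthomx1E.
have -> : (vec_of B)^t* = (vec_of (map_mx Num.conj B))^T.
  by apply/matrixP => i j; rewrite !mxE.
rewrite vec_of_dot -map_trmx; apply/eqP/eqP => [|->]; last by rewrite raddf0.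
by move/matrixP/(_ 0 0); rewrite !mxE eqxx mulr1n.
Qed.
End TensorSquare.

Section Representation.
Variables (R : realType) (l : nat).
Local Notation C := R[i].
Local Notation n := (l + l)%N.
Local Notation N := (n * n)%N.
Implicit Types (X A : 'M[C]_n) (h : 'M[C]_n -> Prop) (U W f : 'M[C]_N).

Lemma vec_of_act X A : vec_of A *m row_act X = vec_of (X *m A + A *m X^T).
Proof.
rewrite /row_act /tens_rep [(_ + _)^T]linearD /= !trmx_tens trmx1 mulmxDr.
rewrite !vec_of_mul trmxK.
by rewrite trmx1 mul1mx mulmx1 -linearD.
Qed.

Fact row_act_linear : linear (@row_act R l).
Proof.
by move=> c X Y; apply/matrixP => a b; rewrite !mxE; ring.
Qed.
HB.instance Definition _ :=
  GRing.isLinear.Build _ _ _ _ (@row_act R l) row_act_linear.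

(** The reason why Hermitian complements of invariant subspaces are invariant. *)
Lemma row_act_adj X : X^t* = - X -> (row_act X)^t* = - row_act X.
Proof.
move=> Xs; rewrite -linearN -Xs /= /row_act /tens_rep trmxK.
rewrite map_mxD !map_mxT map_mx1 /= [(_ + _)^T]linearD /= !trmx_tens trmx1.
by rewrite map_trmx trmxK.
Qed.

End Representation.

(** * Schur's lemma and the commutant *)

Section Projections.
Variables (F : fieldType) (n : nat).
Implicit Types U V W f : 'M[F]_n.

Lemma stable_cap U V f :
  stablemx U f -> stablemx V f -> stablemx (U :&: V)%MS f.
Proof.
move=> Uf Vf; rewrite sub_capmx.
rewrite (submx_trans (submxMr f (capmxSl U V))) //.
by rewrite (submx_trans (submxMr f (capmxSr U V))).
Qed.

(** With [P] the projection, stability of [U] gives [P *m f *m P = P *m f], and stability of [V]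
    gives that [1%:M - P] followed by [f] and [P] is zero. *)
Lemma proj_mx_comm U V f : (U :&: V = 0)%MS -> (1%:M <= U + V)%MS ->
  stablemx U f -> stablemx V f -> f *m proj_mx U V = proj_mx U V *m f.
Proof.
move=> dxUV fullUV Uf Vf; set P := proj_mx U V.
have PfP : P *m f *m P = P *m f.
  apply: proj_mx_id => //; apply: submx_trans Uf.
  by rewrite submxMr // -[P]mul1mx proj_mx_sub.
have QfP : (1%:M - P) *m f *m P = 0.
  apply: proj_mx_0 => //; apply: submx_trans Vf.
  by rewrite submxMr // -[P]mul1mx proj_mx_compl_sub.
by move: QfP; rewrite !mulmxBl mul1mx PfP => /eqP; rewrite subr_eq0 => /eqP.
Qed.

Definition family_proj k (U : 'I_k -> 'M[F]_n) i : 'M[F]_n :=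
  proj_mx (U i) (\sum_(j | j != i) U j)%MS.

Section Family.
Variables (k : nat) (U : 'I_k -> 'M[F]_n).
Hypotheses (dxU : mxdirect (\sum_i U i)) (fullU : (1%:M <= \sum_i U i)%MS).
Local Notation P := (family_proj U).

Lemma family_cap i : (U i :&: \sum_(j | j != i) U j = 0)%MS.
Proof. by have /mxdirect_sumsP/(_ i isT) := dxU. Qed.

Lemma family_projE i j : U i *m P j = if i == j then U i else 0.
Proof.
have [<-|ij] := eqVneq i j; first by rewrite proj_mx_id ?family_cap.
by rewrite proj_mx_0 ?family_cap // (sumsmx_sup i).
Qed.

Lemma family_ext f g : (forall i, U i *m f = U i *m g) -> f = g.
Proof.
move=> fg; apply/eqP; rewrite -subr_eq0 -[f - g]mul1mx -sub_kermx.
apply: submx_trans fullU _; apply/sumsmx_subP => i _.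
by rewrite sub_kermx mulmxBr fg subrr.
Qed.

(** The projections sum to the identity, so [f] is the sum of the [f *m P j], and the hypothesis
    computes these on each [U i]. *)
Lemma family_combination f (c : 'I_k -> F) :
  (forall i j, U i *m (f *m P j) = if i == j then c i *: U i else 0) ->
  f = \sum_i c i *: P i.
Proof.
move=> fc; have sumP : \sum_j P j = 1%:M.
  apply: family_ext => i; rewrite mulmx1 mulmx_sumr (bigD1 i) //=.
  rewrite family_projE eqxx big1 ?addr0 // => j ji.
  by rewrite family_projE eq_sym (negPf ji).
apply: family_ext => i; transitivity (\sum_j U i *m (f *m P j)).
  by rewrite -mulmx_sumr -mulmx_sumr sumP mulmx1.
rewrite mulmx_sumr; apply: eq_bigr => j _.
rewrite fc -scalemxAr family_projE.
by have [<-|ij] := eqVneq i j; rewrite ?scaler0.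
Qed.

Lemma family_proj_comm f i :
  (forall j, stablemx (U j) f) -> f *m P i = P i *m f.
Proof.
move=> Uf; apply: proj_mx_comm; rewrite ?family_cap //.
  by apply: submx_trans fullU _; rewrite (bigD1 i).
apply: (submx_trans (_ : (_ <= (\sum_(j | j != i) (U j *m f))%MS)%MS)).
  by rewrite sumsmxMr_gen; apply/sumsmx_subP => j ji; rewrite genmxE (sumsmx_sup j).
by apply/sumsmx_subP => j ji; rewrite (submx_trans (Uf j)) // (sumsmx_sup j).
Qed.

(** Multiplying a linear relation by [U j] isolates its coefficient of index [j]. The transposes are
    there because the commutant is defined by the action on columns. *)
Lemma family_proj_free : (forall i, U i != 0) ->
  row_free (\matrix_i mxvec (P i)^T).
Proof.
move=> U0; apply: inj_row_free => v.
have -> : v *m \matrix_i mxvec (P i)^T = mxvec (\sum_i v 0 i *: P i)^T.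
  rewrite mulmx_sum_row !linear_sum; apply: eq_bigr => i _.
  by rewrite rowK linearZ [in RHS]linearZ.
move/eqP; rewrite mxvec_eq0 trmx_eq0 => /eqP s0.
apply/rowP => j; rewrite mxE; apply/eqP.
have /eqP : U j *m (\sum_i v 0 i *: P i) = 0 by rewrite s0 mulmx0.
rewrite mulmx_sumr (bigD1 j) //= -scalemxAr family_projE eqxx big1 ?addr0.
  by rewrite scaler_eq0 (negPf (U0 j)) orbF.
by move=> i ij; rewrite -scalemxAr family_projE eq_sym (negPf ij) scaler0.
Qed.
End Family.
End Projections.

Section Schur.
Variables (R : realType) (l : nat) (h : 'M[R[i]]_(l + l) -> Prop).
Local Notation C := R[i].
Local Notation N := ((l + l) * (l + l))%N.
Implicit Types U W f : 'M[C]_N.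

(** The last clause of [equiv_on]: [f] is a matrix on all of V ⊗ V, but only its restriction to [U]
    has to commute with the action. *)
Definition intertwines_on U f :=
  forall X, h X -> U *m (row_act X *m f - f *m row_act X) = 0.

Lemma intertwinesE U f X : intertwines_on U f -> h X ->
  U *m row_act X *m f = U *m f *m row_act X.
Proof.
by move=> Uf /Uf /eqP; rewrite mulmxBr subr_eq0 !mulmxA => /eqP.
Qed.

(** The kernel of [f] inside [U] is invariant, hence zero or all of [U]. *)
Lemma irreducible_mul U f : irreducible_on h U -> intertwines_on U f ->
  U *m f = 0 \/ \rank (U *m f) = \rank U.
Proof.
case=> Uinv _ Uirr Uf; set K := (U :&: kermx f)%MS.
have Kinv : invariant h K.
  move=> X hX; rewrite sub_capmx (submx_trans _ (Uinv X hX)) ?submxMr ?capmxSl //=.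
  have /submxP[D KD] : (K <= U)%MS by exact: capmxSl.
  rewrite sub_kermx {1}KD -!mulmxA (mulmxA U) intertwinesE // !mulmxA -KD.
  by have /sub_kermxP-> : (K <= kermx f)%MS; rewrite ?capmxSr // mul0mx.
case: (Uirr K Kinv (capmxSl _ _)) => [rK|UK].
  by right; rewrite -[RHS](mxrank_mul_ker U f) rK addn0.
by left; apply/sub_kermxP; apply: submx_trans UK (capmxSr _ _).
Qed.

Lemma image_invariant U f : invariant h U -> intertwines_on U f ->
  invariant h (U *m f).
Proof.
by move=> Uinv Uf X hX; rewrite -intertwinesE // submxMr // Uinv.
Qed.

Lemma schur_equiv U W f : irreducible_on h U -> irreducible_on h W ->
  (U *m f <= W)%MS -> intertwines_on U f -> U *m f = 0 \/ equiv_on h U W.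
Proof.
move=> Uirr [_ _ Wirr] UfW Uf.
have [->|rUf] := irreducible_mul Uirr Uf; [by left | right].
case: Uirr => Uinv rU _; exists f; have := Wirr _ (image_invariant Uinv Uf) UfW.
case=> [r0|WUf]; first by rewrite -rUf r0 in rU.
by split=> //; rewrite -?rUf ?UfW //; apply/eqmx_rank/andP.
Qed.

(** For an eigenvalue [c] of [f] on [U], the map [f - c%:M] intertwines and is not injective on [U],
    so it vanishes there. *)
Lemma schur_scalar U f : irreducible_on h U -> (U *m f <= U)%MS ->
  intertwines_on U f -> exists c, U *m f = c *: U.
Proof.
move=> Uirr UfU Uf; have [_ rU _] := Uirr; set B := row_base U.
have BfB : (B *m f <= B)%MS.
  by rewrite eq_row_base (submx_trans _ UfU) // submxMr // eq_row_base.
(* [B *m f *m pinvmx B] is the matrix of [f] on [U] in the basis [B]; its size [\rank U] is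
   positive. *)
have [c /eigenvalueP[v vc v0]] :=
  eigenvalue_closed (B *m f *m pinvmx B) (n := \rank U) ltac:(by rewrite lt0n).
exists c; have Ufc : intertwines_on U (f - c%:M).
  move=> X hX; rewrite -(Uf X hX); congr (_ *m _).
  by rewrite [X in X - _]mulmxBr mulmxBl scalar_mxC opprB addrA subrK.
have [/eqP|rUfc] := irreducible_mul Uirr Ufc.
  by rewrite mulmxBr mul_mx_scalar subr_eq0 => /eqP.
have := mxrank_mul_ker U (f - c%:M); rewrite rUfc => /eqP.
rewrite -[X in _ == X]addn0 eqn_add2l mxrank_eq0 => /eqP K0.
have : (v *m B <= U :&: kermx (f - c%:M))%MS.
  rewrite sub_capmx (submx_trans (submxMl _ _)) ?eq_row_base //=.
  rewrite sub_kermx mulmxBr mul_mx_scalar scalemxAl -vc -!(mulmxA v).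
  by rewrite mulmxKpV // subrr.
by rewrite K0 submx0 mulmx_free_eq0 ?row_base_free // (negPf v0).
Qed.

Lemma equiv_on_sym U W : invariant h U -> equiv_on h U W -> equiv_on h W U.
Proof.
move=> Uinv [f [/eqmxP UfW rUW Uf]].
(* As [f] preserves the rank of [U], the rows of [B *m f] are independent, and [g] sends them back
   to those of [B]. *)
pose B := row_base U; pose g := pinvmx (B *m f) *m B.
have BU : (B :=: U)%MS := eq_row_base U.
have Bfree : row_free (B *m f).
  by rewrite /row_free (eqmxMr f BU) UfW rUW.
have Ufg : U *m f *m g = U.
  have /submxP[D UD] : (U <= B)%MS by rewrite BU.
  have UfD : U *m f = D *m (B *m f) by rewrite mulmxA -UD.
  by rewrite /g mulmxA UfD -(mulmxA D) mulmxVp // mulmx1 -UD.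
exists g; split=> //.
  by apply/eqmxP; rewrite -[X in (_ :=: X)%MS]Ufg; apply/eqmxMr/eqmx_sym.
move=> X hX; have /submxP[D ->] : (W <= U *m f)%MS by rewrite UfW.
suff key : U *m f *m (row_act X *m g - g *m row_act X) = 0.
  by rewrite -mulmxA key mulmx0.
rewrite mulmxBr [X in _ - X]mulmxA Ufg mulmxA -(intertwinesE Uf hX).
by have /submxP[D' ->] := Uinv X hX; rewrite -!mulmxA (mulmxA U) Ufg subrr.
Qed.

Lemma in_commutantE M :
  in_commutant h M <-> forall X, h X -> row_act X *m M^T = M^T *m row_act X.
Proof.
rewrite /in_commutant /row_act.
split=> hM X /hM /(congr1 trmx).
  by rewrite !trmx_mul.
by rewrite !trmx_mul !trmxK => ->.
Qed.

Section Decomposition.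
Variables (k : nat) (U : 'I_k -> 'M[C]_N).
Hypotheses (dxU : mxdirect (\sum_i U i)) (fullU : (1%:M <= \sum_i U i)%MS).
Hypotheses (Uinv : forall i, invariant h (U i)) (U0 : forall i, U i != 0).
Local Notation P := (family_proj U).

Lemma family_proj_commutant i : in_commutant h (P i)^T.
Proof.
apply/in_commutantE => X hX; rewrite trmxK.
by apply: family_proj_comm => // j; apply: Uinv.
Qed.

Lemma leq_commutant_dim d : commutant_dim h d -> (k <= d)%N.
Proof.
case=> B [_ hB]; have /eqP <- := family_proj_free dxU U0.
apply: leq_trans (mxrankS (_ : (_ <= B)%MS)) (rank_leq_row B).
by apply/row_subP => i; rewrite rowK; apply/hB/family_proj_commutant.
Qed.

Hypotheses (Uirr : forall i, irreducible_on h (U i))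
  (Uineq : forall i j, i != j -> ~ equiv_on h (U i) (U j)).

(** By Schur's lemma a commuting matrix has zero blocks between different summands and scalar
    diagonal blocks, so the projections form a basis. *)
Lemma commutant_dim_irreducible : commutant_dim h k.
Proof.
exists (\matrix_i mxvec (P i)^T); split; first exact: family_proj_free.
move=> M; split=> [/in_commutantE cM|]; last first.
  case/submxP => v; rewrite mulmx_sum_row => /(canRL mxvecK) ->.
  move=> X hX; rewrite linear_sum mulmx_suml mulmx_sumr; apply: eq_bigr => i _.
  rewrite rowK linearZ /= mxvecK -scalemxAl -scalemxAr; congr (_ *: _).
  exact: family_proj_commutant.
have cMP i j : intertwines_on (U i) (M^T *m P j).
  move=> X hX; have := family_proj_commutant j.
  move/in_commutantE/(_ X hX); rewrite trmxK => cP.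
  by rewrite -[_ *m P j *m _]mulmxA -cP !mulmxA cM // subrr mulmx0.
have UMP i j : i != j -> U i *m (M^T *m P j) = 0.
  move=> ij; have := schur_equiv (Uirr i) (Uirr j) _ (cMP i j).
  rewrite mulmxA proj_mx_sub => /(_ isT) [-> //|].
  by move/(Uineq ij).
have /choice [c Hc] i : exists c, U i *m (M^T *m P i) = c *: U i.
  by apply: schur_scalar (cMP i i); rewrite // mulmxA proj_mx_sub.
have MT : M^T = \sum_i c i *: P i.
  apply: family_combination => // i j.
  by have [<-|ij] := eqVneq i j; [exact: Hc | exact: UMP].
rewrite -[M]trmxK MT !linear_sum summx_sub // => i _.
rewrite 2!linearZ scalemx_sub //.
by have := row_sub i (\matrix_i mxvec (P i)^T); rewrite rowK.
Qed.
End Decomposition.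
End Schur.

(** * Hermitian complements and rank-one elements of the symplectic algebra *)

Section SkewHermitian.
Variables (K : numClosedFieldType) (n : nat).
Implicit Type X : 'M[K]_n.

(** Both brackets have the form [Y - Y^t*], for [Y = X] and [Y = 'i *: X], so both are
    skew-Hermitian. *)
Lemma skew_decomposition X :
  X = 2^-1 *: (X - X^t*) + (2^-1 * - 'i) *: ('i *: X - (- 'i) *: X^t*).
Proof.
have ii : - 'i * 'i = 1 :> K by rewrite mulNr -expr2 sqrCi opprK.
have -> : 'i *: X - (- 'i) *: X^t* = 'i *: (X + X^t*).
  by rewrite scaleNr opprK scalerDr.
rewrite scalerA -mulrA ii mulr1 -scalerDr addrACA addNr addr0 -mulr2n.
by rewrite -scaler_nat scalerA mulVf ?scale1r // pnatr_eq0.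
Qed.

Lemma skew_adj X : (X - X^t*)^t* = - (X - X^t*).
Proof. by rewrite linearB map_mxB trmxCK opprB. Qed.

Lemma iskew_adj X :
  ('i *: X - (- 'i) *: X^t*)^t* = - ('i *: X - (- 'i) *: X^t*).
Proof.
apply/matrixP => i j; rewrite !mxE rmorphB !rmorphM rmorphN /= conjCi conjCK.
by ring.
Qed.

Lemma complex_scale (c : K) X Y : c *: (X + 'i *: Y) =
  ('Re c *: X - 'Im c *: Y) + 'i *: ('Im c *: X + 'Re c *: Y).
Proof.
apply/matrixP => i j; rewrite !mxE {1}[c]Crect.
have ii : 'i * 'i = -1 :> K by rewrite -expr2 sqrCi.
rewrite [LHS](_ : _ = 'Re c * X i j + ('i * 'i) * ('Im c * Y i j) +
  'i * ('Im c * X i j + 'Re c * Y i j)); last by ring.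
by rewrite ii; ring.
Qed.

(** ['i *: Y] is Hermitian because [Y] is skew-Hermitian, and it is also a difference of
    skew-Hermitian matrices. *)
Lemma skew_im X Y : X^t* = - X -> Y^t* = - Y ->
  (X + 'i *: Y)^t* = - (X + 'i *: Y) -> Y = 0.
Proof.
move=> /matrixP Xs /matrixP Ys /matrixP XYs; apply/matrixP => i j.
have := XYs i j; have := Xs i j; have := Ys i j; rewrite !mxE.
rewrite rmorphD rmorphM /= conjCi => -> ->; rewrite mulrNN opprD.
by move/addrI/eqP; rewrite eq_sym eqNr mulf_eq0 (negPf (neq0Ci _)) => /eqP.
Qed.

Lemma wedge_adj (u v : 'cV[K]_n) (u' := map_mx Num.conj u)
    (v' := map_mx Num.conj v) :
  (u *m v^T - v *m u^T)^t* = v' *m u'^T - u' *m v'^T.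
Proof.
apply/matrixP => i j; rewrite !mxE !big_ord1 !mxE rmorphB !rmorphM.
by congr (_ - _); apply: mulrC.
Qed.

Lemma ortho_sub m1 m2 (W : 'M[K]_n) (u : 'M[K]_(m1, n)) (v : 'M[K]_(m2, n)) :
  (u <= W)%MS -> (v <= W^!)%MS -> (u <= v^!)%MS.
Proof. by move=> uW; rewrite orthomx_sym; apply: submx_trans. Qed.

Lemma ortho_genmx m1 m2 (u : 'M[K]_(m1, n)) (v : 'M[K]_(m2, n)) :
  (u <= <<v>>^!)%MS = (u <= v^!)%MS.
Proof. by rewrite orthomx_sym genmxE orthomx_sym. Qed.
End SkewHermitian.

Section Ortho.
Variables (R : realType) (l : nat) (h : 'M[R[i]]_(l + l) -> Prop).
Local Notation C := R[i].
Local Notation N := ((l + l) * (l + l))%N.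
Implicit Types U W f : 'M[C]_N.

(** Up to sign, [row_act X] moves to the other side of the Hermitian pairing, where it preserves
    [W]. *)
Lemma ortho_invariant W : (forall X, h X -> X^t* = - X) ->
  invariant h W -> invariant h W^!%MS.
Proof.
move=> hskew Winv X hX; apply/orthomx1P; set V := W^!%MS.
have /submxP[D WD] := Winv X hX.
have VW : V *m W^t* = 0 by exact/orthomx1P.
rewrite -[row_act X]opprK -row_act_adj ?hskew // mulmxN mulNmx -mulmxA.
by rewrite -map_mxM -trmx_mul WD trmx_mul map_mxM mulmxA VW mul0mx oppr0.
Qed.

Lemma ortho_split U W : (W <= U)%MS -> direct_sum2 U W (U :&: W^!)%MS.
Proof.
move=> WU; have cap0 : (W :&: (U :&: W^!) = 0)%MS.
  apply/eqP; rewrite -submx0 -(orthomx_ortho_disj W) capmxS //.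
  exact: capmxSr.
have sumU : (W + (U :&: W^!) :=: U)%MS.
  apply/eqmxP; rewrite addsmx_sub WU capmxSl /= (capmxC U) matrix_modl //.
  by rewrite sub_capmx submx_refl andbT addsmx_ortho submx1.
by split; [exact/eqmxP | rewrite -mxrank_disjoint_sum // sumU].
Qed.

(** If a nonzero invariant [W] inside [U] were proper, its complement in [U] would contain a nonzero
    [z]. *)
Lemma irreducible_ortho U : invariant h U -> U != 0 ->
  (forall W (w z : 'rV_N), invariant h W ->
     (w <= W)%MS -> (w <= U)%MS -> (z <= W^!)%MS -> (z <= U)%MS ->
     w != 0 -> z = 0) ->
  irreducible_on h U.
Proof.
move=> Uinv U0 key; split=> // [|W Winv WU]; first by rewrite mxrank_eq0 U0.
have [->|/rowV0Pn[w wW w0]] := eqVneq W 0; [by left; rewrite mxrank0 | right].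
have cap0 : (U :&: W^!)%MS = 0.
  apply/eqP/rowV0P => z; rewrite sub_capmx => /andP[zU zW].
  exact: (key W w z Winv wW (submx_trans wW WU) zW zU w0).
have [/eqmxP sumU _] := ortho_split WU.
by rewrite -sumU cap0 addsmx_sub submx_refl sub0mx.
Qed.
End Ortho.

Section Symplectic.
Variables (R : realType) (l : nat).
Local Notation C := R[i].
Local Notation n := (l + l)%N.
Local Notation N := (n * n)%N.
Local Notation J := (Jmx R l).
Implicit Types (X A : 'M[C]_n) (u v : 'cV[C]_n).

Lemma trJ : J^T = - J.
Proof.
rewrite /Jmx tr_block_mx linearN /= !trmx0 trmx1 opp_block_mx.
by rewrite !oppr0 opprK.
Qed.

Lemma mulJJ : J *m J = - 1%:M.
Proof.
rewrite /Jmx mulmx_block !mul0mx !mulmx0 !mulmxN !mulNmx !mulmx1 !addr0 !add0r.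
by rewrite scalar_mx_block opp_block_mx !oppr0.
Qed.

Lemma mulJTJ : J^T *m J = 1%:M.
Proof. by rewrite trJ mulNmx mulJJ opprK. Qed.

Lemma mulJJT : J *m J^T = 1%:M.
Proof. by rewrite trJ mulmxN mulJJ opprK. Qed.

Lemma conjJ : map_mx Num.conj J = J.
Proof. by rewrite /Jmx map_block_mx map_mxN !map_mx0 map_mx1. Qed.

(* sp(2l,C), the complexification of sp(l). *)
Definition in_spC X := X^T *m J + J *m X = 0.

(** In this form the condition says that [X] kills the tensor [J], and also that [X *m J^T] is
    symmetric. *)
Lemma in_spC_dual X : in_spC X -> X *m J + J *m X^T = 0.
Proof.
move=> Xsp; have : J *m (X^T *m J + J *m X) *m J = 0.
  by rewrite Xsp mulmx0 mul0mx.
rewrite mulmxDr mulmxDl !mulmxA mulJJ -!mulmxA mulJJ mulmxN mulmx1.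
rewrite !mulmxA !mulNmx !mul1mx mulmxN -opprD => /eqP.
by rewrite oppr_eq0 addrC => /eqP.
Qed.

Lemma tr_in_spC X : in_spC X -> \tr X = 0.
Proof.
move=> /in_spC_dual/(congr1 (fun Y => \tr (Y *m J^T))).
rewrite mul0mx mxtrace0 mulmxDl mxtraceD -mulmxA mulJJT mulmx1.
rewrite mxtrace_mulC mulmxA mulJTJ mul1mx mxtrace_tr => /eqP.
by rewrite -mulr2n mulrn_eq0 /= => /eqP.
Qed.

Lemma in_spC_adj X : in_spC X -> in_spC (X^t*).
Proof.
move=> /in_spC_dual/(congr1 (map_mx Num.conj)).
rewrite map_mx0 map_mxD !map_mxM conjJ /in_spC => <-.
by rewrite -map_trmx trmxK map_trmx.
Qed.

(** Extends linear conditions on [X] from sp(l) to its complexification, by splitting [X] into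
    skew-Hermitian elements. *)
Lemma in_spC_ind (P : 'M[C]_n -> Prop) :
  (forall X Y, P X -> P Y -> P (X + Y)) ->
  (forall c X, P X -> P (c *: X)) -> (forall X, in_sp X -> P X) ->
  forall X, in_spC X -> P X.
Proof.
move=> PD PZ Psp X Xsp.
have spB Y Z : in_spC Y -> in_spC Z -> in_spC (Y - Z).
  rewrite /in_spC linearB mulmxBl mulmxBr addrACA -opprD => -> ->.
  by rewrite subr0.
have spZ c Y : in_spC Y -> in_spC (c *: Y).
  rewrite /in_spC linearZ -!scalemxAl -scalemxAr -scalerDr => ->.
  by rewrite scaler0.
have Xasp := in_spC_adj Xsp.
have skew Y : in_spC Y -> Y^t* = - Y -> P Y.
  move=> Ysp YT; apply: Psp; split=> //.
  by split; [rewrite map_trmx | exact: tr_in_spC].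
rewrite (skew_decomposition X).
apply: (PD); apply: (PZ); apply: skew.
- exact: spB.
- exact: skew_adj.
- by apply: spB; apply: spZ.
- exact: iskew_adj.
Qed.

(** An infinitesimal symplectic transvection. It squares to zero, so it is skew-Hermitian only if it
    is zero; hence the passage to [in_spC]. *)
Definition rank1 u : 'M[C]_n := u *m u^T *m J.

Lemma rank1_spC u : in_spC (rank1 u).
Proof.
by rewrite /in_spC /rank1 !trmx_mul trmxK trJ !mulNmx !mulmxA addNr.
Qed.

Lemma rank1_act u A :
  rank1 u *m A + A *m (rank1 u)^T =
  u *m (A^T *m J^T *m u)^T + A *m J^T *m u *m u^T.
Proof. by rewrite /rank1 !trmx_mul !trmxK !mulmxA. Qed.

Lemma rank1_act_sym u A : A^T = A -> let a := A *m J^T *m u in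
  rank1 u *m A + A *m (rank1 u)^T = u *m a^T + a *m u^T.
Proof. by move=> AT; rewrite rank1_act AT. Qed.

Lemma rank1_act_alt u A : A^T = - A -> let a := A *m J^T *m u in
  rank1 u *m A + A *m (rank1 u)^T = a *m u^T - u *m a^T.
Proof. by move=> AT; rewrite rank1_act AT !mulNmx linearN mulmxN addrC. Qed.

Lemma dot_JT u : dot u (J^T *m u) = 0.
Proof.
by rewrite -bformE bform_anti // trmxK trJ opprK.
Qed.

(** The first action gives [u *m a^T + a *m u^T]. As [u] is isotropic for [J], this matrix sends
    [J^T *m u] to a multiple of [u], so the second action leaves only [u *m u^T]. *)
Lemma rank1_act2_sym u A : A^T = A ->
  vec_of A *m row_act (rank1 u) *m row_act (rank1 u) =
  (2 * bform (J *m A *m J^T) u u) *: vec_of (u *m u^T).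
Proof.
move=> AT; rewrite !vec_of_act (rank1_act_sym u AT).
set a := A *m J^T *m u; rewrite rank1_act_sym; last first.
  by rewrite linearD /= !trmx_mul !trmxK addrC.
rewrite -linearZ; congr vec_of.
have -> : (u *m a^T + a *m u^T) *m J^T *m u = bform (J *m A *m J^T) u u *: u.
  rewrite -mulmxA mulmxDl !outer_mul dot_JT scale0r addr0; congr (_ *: _).
  by rewrite bformE dotC dot_adj trmxK /a !mulmxA.
by rewrite linearZ -scalemxAr -scalemxAl -scalerDl [2 * _]mulr_natl.
Qed.

(** In the second action the role of [a] is played by a multiple of [u], and the two terms
    cancel. *)
Lemma rank1_act2_alt u A : A^T = - A ->
  vec_of A *m row_act (rank1 u) *m row_act (rank1 u) = 0.
Proof.
move=> AT; rewrite !vec_of_act (rank1_act_alt u AT).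
set a := A *m J^T *m u; rewrite rank1_act_alt; last first.
  by rewrite linearB /= !trmx_mul !trmxK opprB.
have -> : (a *m u^T - u *m a^T) *m J^T *m u = - dot a (J^T *m u) *: u.
  by rewrite -mulmxA mulmxBl !outer_mul dot_JT scale0r sub0r scaleNr.
by rewrite linearZ -scalemxAr -scalemxAl subrr linear0.
Qed.
End Symplectic.

(** * Irreducible pieces of the tensor square *)

Lemma sub_rowV (F : fieldType) (m n p : nat) (U : 'M[F]_(m, n)) (f : 'M[F]_(n, p))
    (V : 'M[F]_p) :
  (forall w : 'rV_n, (w <= U)%MS -> (w *m f <= V)%MS) -> (U *m f <= V)%MS.
Proof.
by move=> UV; apply/row_subP => i; rewrite row_mul UV // row_sub.
Qed.

Section Pieces.
Variables (R : realType) (l : nat).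
Local Notation C := R[i].
Local Notation n := (l + l)%N.
Local Notation N := (n * n)%N.
Local Notation J := (Jmx R l).
Local Notation Sym := (Sym2 R n).
Local Notation Alt := (Alt2 R n).
Implicit Types (X A Z : 'M[C]_n) (u v : 'cV[C]_n) (h : 'M[C]_n -> Prop).

(* The line spanned by the invariant bivector, and its complement in [Alt]. *)
Definition Omega : 'M[C]_N := <<vec_of J>>%MS.
Definition Alt0 : 'M[C]_N := (Alt :&: Omega^!)%MS.

Lemma Sym_invariant h : invariant h Sym.
Proof.
move=> X _; apply: sub_rowV => w; have [A ->] := vec_ofP w.
rewrite vec_of_act !sub_Sym2 => /eqP AT.
by rewrite linearD /= !trmx_mul AT trmxK [X in _ == X]addrC.
Qed.

Lemma Sym2_neq0 : (0 < l)%N -> Sym != 0.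
Proof.
move=> l_gt0; apply/rowV0Pn; exists (vec_of 1%:M).
  by rewrite sub_Sym2 trmx1.
by rewrite vec_of_eq0 -mxrank_eq0 mxrank1 addn_eq0 andbb -lt0n.
Qed.

Lemma Alt_invariant h : invariant h Alt.
Proof.
move=> X _; apply: sub_rowV => w; have [A ->] := vec_ofP w.
rewrite vec_of_act !sub_Alt2 => /eqP AT.
by rewrite linearD /= !trmx_mul AT trmxK mulNmx mulmxN -opprD [X in _ == - X]addrC.
Qed.

Lemma Omega_act X : in_spC X -> Omega *m row_act X = 0.
Proof.
move=> Xsp; apply/eqP; rewrite -submx0 (eqmxMr _ (genmxE _)) vec_of_act.
by rewrite in_spC_dual // linear0 sub0mx.
Qed.

Lemma Omega_sub_Alt : (Omega <= Alt)%MS.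
Proof. by rewrite genmxE sub_Alt2 trJ. Qed.

Lemma Omega_irreducible h : (0 < l)%N -> (forall X, h X -> in_spC X) ->
  irreducible_on h Omega.
Proof.
move=> l_gt0 hsp.
have J0 : vec_of J != 0.
  rewrite vec_of_eq0; apply: contraTneq l_gt0 => J0.
  have := mulJJT R l; rewrite J0 mul0mx => /esym/(congr1 (@mxtrace _ _)).
  rewrite mxtrace0 mxtrace1 => /eqP; rewrite pnatr_eq0 addnn double_eq0.
  by move/eqP->.
have rO : \rank Omega = 1%N by rewrite genmxE rank_rV J0.
split=> [X hX||W _ WO]; first by rewrite Omega_act ?sub0mx //; apply: hsp.
  by rewrite rO.
have [->|rW] := eqVneq (\rank W) 0%N; [by left | right].
rewrite -mxrank_leqif_sup // rO eqn_leq lt0n rW andbT -rO.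
exact: mxrankS.
Qed.

Lemma Sym_Alt_split : direct_sum2 1%:M Sym Alt.
Proof.
have cap0 : (Sym :&: Alt = 0)%MS.
  apply/eqP/rowV0P => w; have [A ->] := vec_ofP w.
  rewrite sub_capmx => /andP[wS wA].
  have AT := Sym2_tr wS; have := Alt2_tr wA; rewrite AT => AA.
  apply/eqP; rewrite vec_of_eq0; apply/eqP/matrixP => i j; rewrite mxE.
  by have /matrixP/(_ i j) := AA; rewrite mxE => /esym/eqP; rewrite eqNr => /eqP.
have sum1 : (Sym + Alt == 1%:M)%MS.
  rewrite submx1 /= -[X in (X <= _)%MS]mulmx1; apply: sub_rowV => w _.
  rewrite mulmx1; have [A ->] := vec_ofP w.
  have -> : A = 2^-1 *: (A + A^T) + 2^-1 *: (A - A^T).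
    by apply/matrixP => i j; rewrite !mxE; field.
  rewrite (linearD (@vec_of C n)); apply: addmx_sub_adds.
    by rewrite sub_Sym2; apply/eqP; apply/matrixP => i j; rewrite !mxE addrC.
  by rewrite sub_Alt2; apply/eqP/matrixP => i j; rewrite !mxE -mulrN opprB.
split=> //; rewrite -mxrank_disjoint_sum //; exact: eqmx_rank.
Qed.

Lemma ortho_pairing (W : 'M[C]_N) A Z :
  (vec_of A <= W)%MS -> (vec_of Z <= W^!)%MS -> \tr (A *m Z^t*) = 0.
Proof.
by move=> AW ZW; have := ortho_sub AW ZW; rewrite ortho_vec_of => /eqP.
Qed.

Lemma sub_Alt0 A : (vec_of A <= Alt0)%MS = (A^T == - A) && (\tr (A *m J^T) == 0).
Proof.
rewrite /Alt0 sub_capmx; congr (_ && _); first exact: sub_Alt2.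
by rewrite ortho_genmx ortho_vec_of -map_trmx conjJ.
Qed.

Lemma Alt0_tr A : (vec_of A <= Alt0)%MS -> A^T = - A /\ \tr (A *m J^T) = 0.
Proof. by rewrite sub_Alt0 => /andP[/eqP-> /eqP->]. Qed.

(** A scalar matrix of trace zero is zero, and [J^T] is invertible. *)
Lemma mulJT_nonscalar A : \tr (A *m J^T) = 0 -> A != 0 ->
  ~~ is_scalar_mx (A *m J^T).
Proof.
move=> trA; apply: contraNN => /is_scalar_mxP[c Ac].
have A_eq : A = c *: J by rewrite -[A]mulmx1 -(mulJTJ R l) mulmxA Ac mul_scalar_mx.
move: trA; rewrite Ac mxtrace_scalar -mulr_natr => /eqP.
rewrite mulf_eq0 pnatr_eq0 => /orP[/eqP c0|n0]; first by rewrite A_eq c0 scale0r.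
(* Here [l + l] is zero and there are no entries. *)
apply/eqP/matrixP => i; have := leq_ltn_trans (leq0n i) (ltn_ord i).
by rewrite lt0n n0.
Qed.

Section Full.
Variable h : 'M[C]_n -> Prop.
Hypothesis h_sp : forall X, h X <-> in_sp X.

Let h_skew X : h X -> X^t* = - X.
Proof. by move=> /h_sp[_ [Xs _]]; rewrite -map_trmx. Qed.

Lemma invariant_spC U X : invariant h U -> in_spC X -> (U *m row_act X <= U)%MS.
Proof.
move=> Uinv; apply: (in_spC_ind (P := fun X => (U *m row_act X <= U)%MS)).
- by move=> Y Z UY UZ; rewrite linearD mulmxDr addmx_sub.
- by move=> c Y UY; rewrite linearZ -scalemxAr scalemx_sub.
- by move=> Y /h_sp; apply: Uinv.
Qed.

Lemma invariant_vec U X (w : 'rV_N) : invariant h U -> in_spC X ->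
  (w <= U)%MS -> (w *m row_act X <= U)%MS.
Proof.
move=> Uinv Xsp wU; apply: submx_trans (invariant_spC Uinv Xsp).
exact: submxMr.
Qed.

Lemma sym_square U A u : invariant h U -> (vec_of A <= U)%MS -> A^T = A ->
  bform (J *m A *m J^T) u u != 0 -> (vec_of (u *m u^T) <= U)%MS.
Proof.
move=> Uinv AU AT q0; have Xsp := rank1_spC u.
have := invariant_vec Uinv Xsp (invariant_vec Uinv Xsp AU).
by rewrite rank1_act2_sym // eqmx_scale // mulf_neq0 // pnatr_eq0.
Qed.

Lemma conjJ_form_neq0 A : A^T = A -> A != 0 ->
  exists u, bform (J *m A *m J^T) u u != 0.
Proof.
move=> AT A0; apply: sym_form_neq0; first by rewrite !trmx_mul trmxK AT mulmxA.
apply: contraNneq A0 => M0.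
have : J^T *m (J *m A *m J^T) *m J = 0 by rewrite M0 mulmx0 mul0mx.
by rewrite -!mulmxA mulJTJ mulmx1 mulmxA mulJTJ mul1mx => ->.
Qed.

Lemma Sym_irreducible : (0 < l)%N -> irreducible_on h Sym.
Proof.
move=> l_gt0; apply: irreducible_ortho; first exact: Sym_invariant.
  exact: Sym2_neq0.
move=> W w z Winv; have [A ->] := vec_ofP w; have [Z ->] := vec_ofP z.
move=> AW AS ZW ZS; have AT := Sym2_tr AS; have ZT := Sym2_tr ZS.
rewrite vec_of_eq0 => A0; apply: contrapT => /eqP; rewrite vec_of_eq0 => Z0.
have Woinv := ortho_invariant h_skew Winv.
have [v qv] := conjJ_form_neq0 ZT Z0.
have vWo := sym_square Woinv ZW ZT qv.
have [u0 qu0] := conjJ_form_neq0 AT A0.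
(* The pairing of [u *m u^T] with [v *m v^T] is the quadratic form of [(v *m v^T)^t*] at [u], so
   this form must be shown nonzero. *)
have vv0 : (v *m v^T)^t* != 0.
  rewrite map_mx_eq0 trmx_eq0; apply: contraNneq qv => vv0.
  suff -> : v = 0 by rewrite /bform mulmx0 mxE.
  apply/matrixP => i j; rewrite ord1 [RHS]mxE.
  move/matrixP/(_ i i): vv0; rewrite !mxE big_ord1 mxE => /eqP.
  by rewrite mulf_eq0 orbb => /eqP.
have vvT : ((v *m v^T)^t*)^T = (v *m v^T)^t*.
  by rewrite !trmx_mul trmxK map_trmx trmx_mul trmxK.
have [u1 qu1] := sym_form_neq0 vvT vv0.
(* For this [u], the tensor [u *m u^T] lies in [W] although its pairing with [v *m v^T] is
   nonzero. *)
have [u qu] := common_nonzero qu0 qu1.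
have := ortho_pairing (sym_square Winv AW AT qu) vWo.
rewrite -mulmxA mxtrace_mulC /bform.
rewrite [X in \tr X]mx11_scalar mxtrace_scalar mulr1n => ->.
by rewrite eqxx.
Qed.

Lemma Alt0_irreducible : Alt0 != 0 -> irreducible_on h Alt0.
Proof.
move=> Alt00; have h_spC X : h X -> in_spC X by move=> /h_sp[].
have Omega_inv : invariant h Omega.
  by move=> X hX; rewrite Omega_act ?sub0mx //; apply: h_spC.
have Alt0_inv : invariant h Alt0.
  move=> X hX; apply: stable_cap; first exact: Alt_invariant hX.
  exact: ortho_invariant h_skew Omega_inv _ hX.
apply: irreducible_ortho => // W w z Winv.
have [A ->] := vec_ofP w; have [Z ->] := vec_ofP z.
move=> AW A_alt ZW Z_alt.
have [AT trA] := Alt0_tr A_alt; have [ZT trZ] := Alt0_tr Z_alt.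
rewrite vec_of_eq0 => A0; apply: contrapT => /eqP; rewrite vec_of_eq0 => Z0.
have Woinv := ortho_invariant h_skew Winv.
pose Zc := map_mx Num.conj Z.
have trZc : \tr (Zc *m J^T) = 0.
  by rewrite -conjJ map_trmx -map_mxM trace_map_mx trZ rmorph0.
have Zcns : ~~ is_scalar_mx (Zc *m J^T)^T.
  have := mulJT_nonscalar trZc; rewrite map_mx_eq0 => /(_ Z0).
  apply: contraNN => /is_scalar_mxP[c Hc]; apply/is_scalar_mxP; exists c.
  by rewrite -[LHS]trmxK Hc tr_scalar_mx.
(* Orthogonality of [u] and [y] removes one product in [tr_wedge]; the other two conditions make the
   remaining product nonzero. *)
have [u [y [uy0 ay0 dy0]]] := nonscalar_common (mulJT_nonscalar trA A0) Zcns.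
(* The Hermitian pairing conjugates its second argument, so the element acting on [Z] is built on
   the conjugate of [y]. *)
pose v := map_mx Num.conj y.
have := invariant_vec Winv (rank1_spC u) AW.
rewrite vec_of_act rank1_act_alt // => uW.
have := invariant_vec Woinv (rank1_spC v) ZW.
rewrite vec_of_act rank1_act_alt // => vW.
have := ortho_pairing uW vW.
set a := A *m J^T *m u in ay0 *; set d := Zc *m J^T *m y.
have cy : map_mx Num.conj v = y by apply/matrixP => i j; rewrite !mxE conjCK.
set c := Z *m J^T *m v.
have cd : map_mx Num.conj c = d by rewrite !map_mxM -map_trmx conjJ cy.
rewrite wedge_adj cy cd.
have du : dot d u = dot ((Zc *m J^T)^T *m u) y by rewrite dot_adj dotC.
rewrite tr_wedge uy0 mul0r sub0r mulrN => /eqP.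
rewrite oppr_eq0 !mulf_eq0 pnatr_eq0 /= [dot u d]dotC du.
case/orP => [d0|a0]; first by move/negP: dy0; apply; exact: d0.
by move/negP: ay0; apply; exact: a0.
Qed.
End Full.
End Pieces.

(** * Direct sums, and subspaces given by predicates *)

Lemma mxtrace_delta (F : comNzRingType) (n : nat) (M : 'M[F]_n) i j :
  \tr (delta_mx i j *m M) = M j i.
Proof.
rewrite -(mul_delta_mx (0 : 'I_1)) -mulmxA mxtrace_mulC -rowE -colE.
by rewrite trace_mx11 !mxE.
Qed.

Lemma mxdirect_full (F : fieldType) (n k : nat) (U : 'I_k -> 'M[F]_n) :
  (1%:M <= \sum_i U i)%MS -> (\sum_i \rank (U i))%N = n -> mxdirect (\sum_i U i).
Proof.
move=> fullU rU; apply/mxdirectP => /=; rewrite rU.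
by apply/eqP; rewrite -[_ == _]/(row_full _) -sub1mx.
Qed.

Lemma direct_sum4 (F : fieldType) (n : nat) (S A U1 U2 U3 U4 : 'M[F]_n) :
  (U1 + U2 == S)%MS -> (U3 + U4 == A)%MS -> (S + A == 1%:M)%MS ->
  (\rank U1 + \rank U2 = \rank S)%N -> (\rank U3 + \rank U4 = \rank A)%N ->
  (\rank S + \rank A = \rank (1%:M : 'M[F]_n))%N ->
  let U (i : 'I_4) := nth 0 [:: U1; U2; U3; U4] i in
  mxdirect (\sum_i U i) /\ (1%:M <= \sum_i U i)%MS.
Proof.
move=> /eqmxP US /eqmxP UA /eqmxP SA rS rA r1 U.
have full : (1%:M <= \sum_i U i)%MS.
  rewrite !big_ord_recl big_ord0 /U /= addsmx0_id addsmxA.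
  by rewrite (adds_eqmx US UA) SA.
split=> //; apply: mxdirect_full => //.
by rewrite !big_ord_recl big_ord0 /U /= addn0 addnA rS rA r1 mxrank1.
Qed.

Lemma direct_sum3 (F : fieldType) (n : nat) (S A U1 U2 : 'M[F]_n) :
  (U1 + U2 == A)%MS -> (S + A == 1%:M)%MS ->
  (\rank U1 + \rank U2 = \rank A)%N ->
  (\rank S + \rank A = \rank (1%:M : 'M[F]_n))%N ->
  (S + U1 + U2 == 1%:M)%MS /\ (\rank S + \rank U1 + \rank U2 = n)%N.
Proof.
move=> /eqmxP UA /eqmxP SA rA r1; split; last by rewrite -addnA rA r1 mxrank1.
apply/eqmxP; rewrite -addsmxA.
exact: eqmx_trans (adds_eqmx (eqmx_refl S) UA) SA.
Qed.

(** Take [W] of largest rank among the matrices whose row space lies in [P]: a vector of [P] outside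
    it could be added and would raise the rank. *)
Lemma subspace_mx (F : fieldType) (n : nat) (P : 'rV[F]_n -> Prop) :
  P 0 -> (forall u v, P u -> P v -> P (u + v)) ->
  (forall c u, P u -> P (c *: u)) ->
  exists W : 'M[F]_n, forall v, P v <-> (v <= W)%MS.
Proof.
move=> P0 PD PZ.
pose sub (W : 'M[F]_n) := forall v : 'rV_n, (v <= W)%MS -> P v.
pose Q r := `[< exists2 W : 'M[F]_n, \rank W = r & sub W >].
have exQ : exists r, Q r.
  exists 0%N; apply/asboolP; exists 0; rewrite ?mxrank0 // => v.
  by rewrite submx0 => /eqP->.
have ubQ r : Q r -> (r <= n)%N by move=> /asboolP[W <- _]; apply: rank_leq_row.
case: (ex_maxnP exQ ubQ) => r /asboolP[W rW PW] maxr.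
exists W => v; split; last exact: PW.
move=> Pv; apply/negPn/negP => vW.
have : Q (\rank (W + v)%MS).
  apply/asboolP; exists (W + v)%MS => // w /sub_addsmxP[[a b] ->] /=.
  apply: PD; first by apply: PW; apply: submxMl.
  by rewrite [b]mx11_scalar mul_scalar_mx; apply: PZ.
move/maxr; rewrite -rW leqNgt => /negP; apply.
rewrite (ltn_leqif (mxrank_leqif_sup (addsmxSl W v))).
by rewrite addsmx_sub submx_refl.
Qed.

(** * Inequivalence of the three pieces *)

Section Equivalences.
Variables (R : realType) (l : nat).
Local Notation C := R[i].
Local Notation n := (l + l)%N.
Local Notation N := (n * n)%N.
Local Notation J := (Jmx R l).
Local Notation Sym := (Sym2 R n).
Local Notation Alt := (Alt2 R n).
Local Notation Omega := (Omega R l).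
Local Notation Alt0 := (Alt0 R l).
Hypothesis l_gt1 : (1 < l)%N.

(** Since [1 < l], there are two distinct basis vectors in the first half, where [J] vanishes; their
    wedge is orthogonal to [J]. *)
Lemma Alt0_neq0 : Alt0 != 0.
Proof.
have l_gt0 := ltnW l_gt1; pose i : 'I_n := lshift l (Ordinal l_gt0).
pose j : 'I_n := lshift l (Ordinal l_gt1).
have ij : (i == j) = false by [].
apply/rowV0Pn; exists (vec_of (delta_mx i j - delta_mx j i)).
  rewrite sub_Alt0 [(_ - _)^T]linearB /= !trmx_delta opprB eqxx /=.
  have JT0 a b : J^T (lshift l a) (lshift l b) = 0.
    by rewrite mxE /Jmx block_mxEul mxE.
  by rewrite mulmxBl (raddfB (@mxtrace C n)) /= !mxtrace_delta !JT0 subrr.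
rewrite vec_of_eq0; apply/eqP => /matrixP/(_ i j); rewrite !mxE ij andbF !eqxx.
by move/eqP; rewrite subr0 oner_eq0.
Qed.

Section FullAlgebra.
Variable h : 'M[C]_n -> Prop.
Hypothesis h_sp : forall X, h X <-> in_sp X.

Lemma intertwines_spC (U f : 'M[C]_N) X : intertwines_on h U f -> in_spC X ->
  U *m row_act X *m f = U *m f *m row_act X.
Proof.
pose P X := U *m row_act X *m f = U *m f *m row_act X.
move=> Uf; apply: (in_spC_ind (P := P)); rewrite /P.
- move=> Y Z; rewrite [row_act (Y + Z)](linearD (@row_act R l)).
  by rewrite !mulmxDr mulmxDl => -> ->.
- move=> c Y; rewrite [row_act (c *: Y)]linearZ /=.
  by rewrite -!scalemxAr -scalemxAl => ->.
- by move=> Y /h_sp; apply: intertwinesE.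
Qed.

Lemma equiv_on_act0 (U W : 'M[C]_N) X : equiv_on h U W -> in_spC X ->
  U *m row_act X = 0 -> W *m row_act X = 0.
Proof.
case=> f [/andP[_ WUf] _ Uf] Xsp UX0; have /submxP[D ->] := WUf.
by rewrite -mulmxA -(intertwines_spC Uf Xsp) UX0 mul0mx mulmx0.
Qed.

(** The intertwiner carries the double action on [U] to the one on [W], and it is injective on [U]
    because the ranks agree. *)
Lemma equiv_on_act2 (U W : 'M[C]_N) X : invariant h U -> equiv_on h U W ->
  in_spC X -> W *m row_act X *m row_act X = 0 ->
  U *m row_act X *m row_act X = 0.
Proof.
move=> Uinv [f [/andP[UfW WUf] rUW Uf]] Xsp W0.
set V := U *m row_act X *m row_act X.
have UX : (U *m row_act X <= U)%MS := invariant_spC h_sp Uinv Xsp.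
have VU : (V <= U)%MS by apply: submx_trans (submxMr _ UX) UX.
have Vf : V *m f = 0.
  have /submxP[D UXD] := UX; rewrite /V UXD -!(mulmxA D) (intertwines_spC Uf Xsp).
  rewrite mulmxA mulmxA -UXD (intertwines_spC Uf Xsp).
  by have /submxP[D' ->] := UfW; rewrite -!(mulmxA D') W0 mulmx0.
have rUf : \rank (U *m f) = \rank U.
  by rewrite rUW; apply/eqmx_rank; rewrite UfW WUf.
have := mxrank_mul_ker U f; rewrite rUf => /eqP.
rewrite -[X in _ == X]addn0 eqn_add2l mxrank_eq0 => /eqP K0.
by apply/eqP; rewrite -submx0 -K0 sub_capmx VU; apply/sub_kermxP.
Qed.

Lemma Sym_not_equiv_sub_Alt (W : 'M[C]_N) : (W <= Alt)%MS -> ~ equiv_on h Sym W.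
Proof.
move=> WA SW; have l_gt0 := ltnW l_gt1; pose i : 'I_n := lshift l (Ordinal l_gt0).
pose u : 'cV[C]_n := delta_mx i 0.
have W0 : W *m row_act (rank1 u) *m row_act (rank1 u) = 0.
  have : (W *m (row_act (rank1 u) *m row_act (rank1 u)) <= (0 : 'M_N))%MS.
    apply: sub_rowV => w wW; have [A wA] := vec_ofP w; rewrite wA in wW *.
    rewrite mulmxA rank1_act2_alt ?sub0mx //.
    exact: Alt2_tr (submx_trans wW WA).
  by rewrite submx0 mulmxA => /eqP.
have S0 := equiv_on_act2 (@Sym_invariant R l h) SW (rank1_spC u) W0.
(* The identity serves as symmetric tensor: its form [J *m J^T] is the identity, with value 1 at the
   basis vector [u]. *)
have /submxP[D D1] : (vec_of (1%:M : 'M[C]_n) <= Sym)%MS by rewrite sub_Sym2 trmx1.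
have := rank1_act2_sym u (trmx1 C n); rewrite D1 -!(mulmxA D) S0 mulmx0.
move/esym/eqP; rewrite scaler_eq0 vec_of_eq0 mulf_eq0 pnatr_eq0 /= mulmx1 mulJJT.
rewrite bform_delta mxE eqxx oner_eq0 /=; apply/negP.
apply/eqP => /matrixP/(_ i i); rewrite /u trmx_delta mul_delta_mx !mxE !eqxx.
by move/eqP; rewrite oner_eq0.
Qed.

Lemma Omega_not_equiv_Alt0 : ~ equiv_on h Omega Alt0.
Proof.
move=> OA; have /rowV0Pn[w wA] := Alt0_neq0; have [A wE] := vec_ofP w.
rewrite wE in wA *; rewrite vec_of_eq0 => A0; have [AT trA] := Alt0_tr wA.
have ns := mulJT_nonscalar trA A0.
have [u [y [uy0 ay0 _]]] := nonscalar_common ns ns.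
have A_act := equiv_on_act0 OA (rank1_spC u) (Omega_act (rank1_spC u)).
have /submxP[D wD] := wA.
have : vec_of A *m row_act (rank1 u) = 0 by rewrite wD -mulmxA A_act mulmx0.
rewrite vec_of_act rank1_act_alt // => /eqP; rewrite vec_of_eq0 => /eqP.
(* With [a] standing for [A *m J^T *m u], only [- dot a y *: u] remains, and neither factor
   vanishes. *)
move/(congr1 (fun M => M *m y)); rewrite mulmxBl !outer_mul uy0.
rewrite scale0r sub0r mul0mx.
move/eqP; rewrite oppr_eq0 scaler_eq0 => /orP[h0|/eqP u0].
  by move/negP: ay0; apply; exact: h0.
by move/eqP: ay0; apply; rewrite u0 mulmx0 /dot /bform linear0 !mul0mx mxE.
Qed.
End FullAlgebra.
End Equivalences.

(** * The implications *)

Section Implications.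
Variables (R : realType) (l : nat) (h : 'M[R[i]]_(l + l) -> Prop).
Local Notation C := R[i].
Local Notation n := (l + l)%N.
Local Notation N := (n * n)%N.
Local Notation J := (Jmx R l).
Local Notation Sym := (Sym2 R n).
Local Notation Alt := (Alt2 R n).
Local Notation Omega := (Omega R l).
Local Notation Alt0 := (Alt0 R l).
Hypotheses (l_gt1 : (1 < l)%N) (h_lie : lie_subalgebra_sp h).

Let l_gt0 : (0 < l)%N := ltnW l_gt1.

Let h_spC X : h X -> in_spC X.
Proof. by have [_ _ _ _ hsp] := h_lie => /hsp[]. Qed.

Let h_skew X : h X -> X^t* = - X.
Proof. by have [_ _ _ _ hsp] := h_lie => /hsp[_ [Xs _]]; rewrite -map_trmx. Qed.

Lemma full_pieces : (forall X, h X <-> in_sp X) ->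
  irreducible_on h Sym /\
  exists U1 U2 : 'M[C]_N,
    [/\ irreducible_on h U1, irreducible_on h U2, direct_sum2 Alt U1 U2 &
        [/\ ~ equiv_on h Sym U1, ~ equiv_on h Sym U2 & ~ equiv_on h U1 U2]].
Proof.
move=> h_sp; split; first exact: Sym_irreducible.
exists Omega, Alt0; split.
- exact: Omega_irreducible.
- exact: Alt0_irreducible h_sp (Alt0_neq0 R l_gt1).
- exact/ortho_split/Omega_sub_Alt.
split.
- exact: Sym_not_equiv_sub_Alt (Omega_sub_Alt R l).
- exact: Sym_not_equiv_sub_Alt (capmxSl _ _).
- exact: Omega_not_equiv_Alt0.
Qed.

Lemma three_commutant_dim (U1 U2 U3 : 'M[C]_N) :
  irreducible_on h U1 -> irreducible_on h U2 -> irreducible_on h U3 ->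
  (1%:M <= U1 + U2 + U3)%MS -> (\rank U1 + \rank U2 + \rank U3 = N)%N ->
  ~ equiv_on h U1 U2 -> ~ equiv_on h U1 U3 -> ~ equiv_on h U2 U3 ->
  commutant_dim h 3.
Proof.
move=> irr1 irr2 irr3 full rN ne12 ne13 ne23.
pose U (i : 'I_3) := nth 0 [:: U1; U2; U3] i.
have Uirr i : irreducible_on h (U i) by case: i => [[|[|[|]]]].
have fullU : (1%:M <= \sum_i U i)%MS.
  by rewrite !big_ord_recl big_ord0 /U /= addsmx0_id addsmxA.
have dxU : mxdirect (\sum_i U i).
  by apply: mxdirect_full => //; rewrite !big_ord_recl big_ord0 /U /= addn0 addnA.
(* The hypotheses cover one order of each pair; symmetry of equivalence supplies the other. *)
have neq_sym V W : irreducible_on h W -> ~ equiv_on h V W -> ~ equiv_on h W V.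
  by move=> [Winv _ _] VW /(equiv_on_sym Winv).
have ne21 := neq_sym _ _ irr2 ne12; have ne31 := neq_sym _ _ irr3 ne13.
have ne32 := neq_sym _ _ irr3 ne23.
apply: (commutant_dim_irreducible dxU fullU) => //.
- by move=> i; case: (Uirr i).
- by move=> i; have [_ rU _] := Uirr i; rewrite -mxrank_eq0.
by case=> [[|[|[|i]]] ilt] [[|[|[|j]]] jlt] //= _; rewrite /U /=; auto.
Qed.

Lemma commutant_dim_Sym_irreducible : commutant_dim h 3 -> irreducible_on h Sym.
Proof.
move=> dim3; have Sym0 : \rank Sym != 0%N.
  by rewrite mxrank_eq0 Sym2_neq0.
split=> //; first exact: Sym_invariant.
move=> W Winv WS; have [->|rW] := eqVneq (\rank W) 0%N; [by left | right].
apply: contrapT => /negP SW.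
pose W' : 'M[C]_N := (Sym :&: W^!)%MS.
have [sumS rS] := ortho_split WS.
have [sumA rA] := ortho_split (Omega_sub_Alt R l).
have [sum1 r1] := Sym_Alt_split R l.
pose U (i : 'I_4) := nth 0 [:: W; W'; Omega; Alt0] i.
have [Oinv rO _] := Omega_irreducible l_gt0 h_spC.
have Uinv i : invariant h (U i).
  case: i => [[|[|[|[|i]]]] ilt] //=; rewrite /U /= => X hX; apply: stable_cap.
  - exact: Sym_invariant hX.
  - exact: ortho_invariant h_skew Winv _ hX.
  - exact: Alt_invariant hX.
  - exact: ortho_invariant h_skew Oinv _ hX.
have [dxU fullU] := direct_sum4 sumS sumA sum1 rS rA r1.
have U0 i : U i != 0.
  case: i => [[|[|[|[|i]]]] ilt] //=; rewrite /U /=.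
  - by rewrite -mxrank_eq0.
  - apply: contra SW => /eqP W'0.
    by move: sumS; rewrite -/W' W'0 addsmx0_id => /andP[].
  - by rewrite -mxrank_eq0.
  - exact: Alt0_neq0.
(* Four nonzero invariant summands give the absurd bound [4 <= 3]. *)
by have := leq_commutant_dim dxU fullU Uinv U0 dim3.
Qed.

Lemma Sym_irreducible_full : irreducible_on h Sym -> forall X, h X <-> in_sp X.
Proof.
have [h0 hD hZ hB hsp] := h_lie.
move=> [_ _ Sirr] X; split=> [|Xsp]; first exact: hsp.
pose P (w : 'rV[C]_N) := exists Y Z,
  [/\ h Y, h Z & w = vec_of ((Y + 'i *: Z) *m J^T)].
have [W PW] : exists W : 'M[C]_N, forall w, P w <-> (w <= W)%MS.
  apply: subspace_mx.
  - by exists 0, 0; split=> //; rewrite scaler0 addr0 mul0mx linear0.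
  - move=> _ _ [Y [Z [hY hZ' ->]]] [Y' [Z' [hY' hZ'' ->]]].
    exists (Y + Y'), (Z + Z'); split; [exact: hD|exact: hD|].
    by rewrite -linearD -mulmxDl scalerDr addrACA.
  - move=> c _ [Y [Z [hY hZ' ->]]].
    exists ('Re c *: Y - 'Im c *: Z), ('Im c *: Y + 'Re c *: Z); split.
    + rewrite -scaleNr; apply: hD; apply: hZ => //.
      by rewrite rpredN Creal_Im.
    + by apply: hD; apply: hZ; rewrite ?Creal_Re ?Creal_Im.
    + by rewrite -linearZ /= scalemxAl complex_scale.
(* By [JT], the action of [T] on [(Y + 'i *: Z) *m J^T] is the bracket of [T] with [Y + 'i *: Z],
   times [J^T]. *)
have Winv : invariant h W.
  move=> T hT; apply: sub_rowV => w /PW[Y [Z [hY hZ' ->]]]; apply/PW.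
  exists (T *m Y - Y *m T), (T *m Z - Z *m T); split; [exact: hB|exact: hB|].
  rewrite vec_of_act; congr vec_of.
  have JT : J^T *m T^T = - (T *m J^T).
    have /eqP := in_spC_dual (h_spC hT).
    by rewrite trJ mulmxN opprK mulNmx addrC addr_eq0 => /eqP->; rewrite opprK.
  rewrite -[in X in _ + X]mulmxA JT mulmxN !mulmxA -mulmxBl; congr (_ *m _).
  by rewrite mulmxDr mulmxDl -scalemxAr -scalemxAl opprD addrACA -scalerBr.
have sp_sym T : in_spC T -> (vec_of (T *m J^T) <= Sym)%MS.
  move=> /in_spC_dual Tsp; rewrite sub_Sym2 trmx_mul trmxK trJ mulmxN.
  by rewrite -addr_eq0 addrC Tsp.
have WS : (W <= Sym)%MS.
  rewrite -[W]mulmx1; apply: sub_rowV => w /PW[Y [Z [hY hZ' ->]]].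
  rewrite mulmx1; apply: sp_sym; rewrite /in_spC.
  have := h_spC hY; have := h_spC hZ'; rewrite /in_spC => Zsp Ysp.
  rewrite linearD linearZ /= mulmxDl mulmxDr addrACA Ysp add0r.
  by rewrite -scalemxAl -scalemxAr -scalerDr Zsp scaler0.
case: (Sirr W Winv WS) => [/eqP rW|SW].
  (* If [W] is zero then so is [h], and every subspace is invariant. The line through [delta_mx i i]
     would be all of [Sym], which also contains the identity. *)
  exfalso; move: rW; rewrite mxrank_eq0 => /eqP W0.
  have h_triv T : h T -> T = 0.
    move=> hT; have : (vec_of (T *m J^T) <= W)%MS.
      by apply/PW; exists T, 0; rewrite scaler0 addr0.
    rewrite W0 submx0 vec_of_eq0 => /eqP TJ0.
    by rewrite -[T]mulmx1 -(mulJTJ R l) mulmxA TJ0 mul0mx.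
  pose i : 'I_n := lshift l (Ordinal l_gt0).
  pose j : 'I_n := rshift l (Ordinal l_gt0).
  pose L : 'M[C]_N := <<vec_of (delta_mx i i)>>%MS.
  have Linv : invariant h L.
    by move=> T /h_triv->; rewrite [row_act 0]linear0 mulmx0 sub0mx.
  have LS : (L <= Sym)%MS by rewrite genmxE sub_Sym2 trmx_delta.
  case: (Sirr L Linv LS) => [/eqP|SL].
    rewrite mxrank_eq0 -submx0 genmxE submx0 vec_of_eq0 => /eqP/matrixP/(_ i i).
    by rewrite !mxE !eqxx => /eqP; rewrite oner_eq0.
  have : (vec_of (1%:M : 'M[C]_n) <= vec_of (delta_mx i i))%MS.
    rewrite -(genmxE (vec_of (delta_mx i i))) (submx_trans _ SL) //.
    by rewrite sub_Sym2 trmx1.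
  case/sub_rVP => c; rewrite -linearZ => /(can_inj (@vec_ofK _ _))/matrixP/(_ j j).
  have ji : (j == i) = false.
    apply/eqP => /(congr1 val) /=; rewrite addn0 => l0.
    by have := l_gt0; rewrite l0.
  by rewrite !mxE eqxx ji mulr0 => /eqP; rewrite oner_eq0.
(* Now [X] is [Y + 'i *: Z] with [Y] and [Z] in [h]; as [X] is skew-Hermitian, [Z] must vanish. *)
have /PW[Y [Z [hY hZ' /(can_inj (@vec_ofK _ _)) XE]]] :
    (vec_of (X *m J^T) <= W)%MS.
  by apply: submx_trans SW; apply: sp_sym; case: Xsp.
have {}XE : X = Y + 'i *: Z.
  by rewrite -[X]mulmx1 -(mulJTJ R l) mulmxA XE -mulmxA mulJTJ mulmx1.
have Xs : X^t* = - X by case: Xsp => _ [Xs _]; rewrite -map_trmx.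
have Z0 : Z = 0.
  by apply: (skew_im (h_skew hY) (h_skew hZ')); rewrite -XE.
by rewrite XE Z0 scaler0 addr0.
Qed.
End Implications.

Theorem theorem4 (R : realType) (l : nat) (h : 'M[R[i]]_(l + l) -> Prop) :
  (2 <= l)%N -> lie_subalgebra_sp h ->
  let N := ((l + l) * (l + l))%N in
  let Sym := Sym2 R (l + l) in
  let Alt := Alt2 R (l + l) in
  (* (a) <-> (b) *)
  ((forall X, h X <-> in_sp X) <-> irreducible_on h Sym) /\
  (* (b) <-> (c) *)
  (irreducible_on h Sym <->
     (irreducible_on h Sym /\
      exists U1 U2 : 'M[R[i]]_N,
        [/\ irreducible_on h U1, irreducible_on h U2,
            direct_sum2 Alt U1 U2 &
            [/\ ~ equiv_on h Sym U1, ~ equiv_on h Sym U2 & ~ equiv_on h U1 U2]])) /\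
  (* (c) <-> (d) *)
  ((irreducible_on h Sym /\
      exists U1 U2 : 'M[R[i]]_N,
        [/\ irreducible_on h U1, irreducible_on h U2,
            direct_sum2 Alt U1 U2 &
            [/\ ~ equiv_on h Sym U1, ~ equiv_on h Sym U2 & ~ equiv_on h U1 U2]]) <->
   (exists U1 U2 U3 : 'M[R[i]]_N,
      [/\ irreducible_on h U1, irreducible_on h U2, irreducible_on h U3,
          (U1 + U2 + U3 == 1%:M)%MS /\ (\rank U1 + \rank U2 + \rank U3 = N)%N &
          [/\ ~ equiv_on h U1 U2, ~ equiv_on h U1 U3 & ~ equiv_on h U2 U3]])) /\
  (* (d) <-> (e) *)
  ((exists U1 U2 U3 : 'M[R[i]]_N,
      [/\ irreducible_on h U1, irreducible_on h U2, irreducible_on h U3,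
          (U1 + U2 + U3 == 1%:M)%MS /\ (\rank U1 + \rank U2 + \rank U3 = N)%N &
          [/\ ~ equiv_on h U1 U2, ~ equiv_on h U1 U3 & ~ equiv_on h U2 U3]]) <->
   commutant_dim h 3).
Proof.
move=> l_gt1 h_lie N Sym Alt.
set b := irreducible_on h Sym; set a := forall X, h X <-> in_sp X.
set c := b /\ _; set d := exists U1 U2 U3, _; set e := commutant_dim h 3.
have ac : a -> c by exact: full_pieces.
have cd : c -> d.
  move=> [Sirr [U1 [U2 [irr1 irr2 [sumA rA] [ne1 ne2 ne12]]]]].
  have [sum1 r1] := Sym_Alt_split R l.
  have [sum3 r3] := direct_sum3 sumA sum1 rA r1.
  by exists Sym, U1, U2; split.
have de : d -> e.
  move=> [U1 [U2 [U3 [irr1 irr2 irr3 [/andP[_ full] rN] [ne12 ne13 ne23]]]]].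
  exact: three_commutant_dim irr1 irr2 irr3 full rN ne12 ne13 ne23.
have eb : e -> b by exact: commutant_dim_Sym_irreducible.
have ba : b -> a by exact: Sym_irreducible_full.
by tauto.
Qed.
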